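(* Let $F$ be the field of $2$ elements, and let $G$ and $H$ be finite $2$-groups of maximal class. Then $V_*(FG)\cong V_*(FH)$ (as groups) if and only if $G\cong H$.
   Context: For a finite group $G$ and a field $F$, $FG$ denotes the group algebra. The augmentation of $x=\sum_{g\in G}\alpha_g g\in FG$ is $\chi(x)=\sum_{g\in G}\alpha_g$, and $V(FG)$ denotes the normalized unit group of $FG$, i.e. the group of units of $FG$ with augmentation $1$. The classical involution $*$ on $FG$ is the $F$-linear map with $g^*=g^{-1}$ for all $g\in G$. An element $u\in V(FG)$ is called unitary if $u^{-1}=u^*$. The unitary subgroup $V_*(FG)$ is the subgroup of $V(FG)$ consisting of all unitary elements. With $(a,b):=a^{-1}b^{-1}ab$, the $2$-groups of maximal class are the following groups (up to isomorphism): the dihedral groups $D_{2^{n+1}}=\langle a,b \mid a^{2^n}=1,\ b^2=1,\ (a,b)=a^{-2}\rangle$ with $n\ge 2$; the generalized quaternion groups $Q_{2^{n+1}}=\langle a,b \mid a^{2^n}=1,\ b^2=a^{2^{n-1}},\ (a,b)=a^{-2}\rangle$ with $n\ge 2$; and the semidihedral groups $D_{2^{n+1}}^-=\langle a,b \mid a^{2^n}=1,\ b^2=1,\ (a,b)=a^{-2+2^{n-1}}\rangle$ with $n\ge 3$. *)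

(* Defs.v *)
From HB Require Import structures.
From mathcomp Require Import all_boot all_order all_algebra all_fingroup.
From mathcomp Require Import all_solvable.

Set Implicit Arguments.
Unset Strict Implicit.
Unset Printing Implicit Defensive.

Import GRing.Theory.
Local Open Scope ring_scope.

(* An element x of the group algebra FG is its coefficient function: x g is   *)
(* the coefficient of g.  The alias keeps the convolution product apart from  *)
(* the pointwise product that {ffun gT -> F} carries in the library.          *)
Definition galg (F : fieldType) (gT : finGroupType) := {ffun gT -> F}.

Section GroupAlgebra.

Variables (F : fieldType) (gT : finGroupType).
Local Notation A := (galg F gT).
Implicit Types (x y z : A) (g h : gT) (c : F).

HB.instance Definition _ := GRing.Zmodule.copy A {ffun gT -> F}.

Definition gelt g : A := [ffun h => (h == g)%:R].

Definition galg_mul x y : A :=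
  [ffun g => \sum_h x h * y (h^-1 * g)%g].

Lemma galg_mulE x y g : galg_mul x y g = \sum_h x h * y (h^-1 * g)%g.
Proof. by rewrite ffunE. Qed.

Lemma galg_mulA : associative galg_mul.
Proof.
move=> x y z; apply/ffunP=> g; rewrite !galg_mulE.
under eq_bigr do rewrite galg_mulE mulr_sumr.
under [RHS]eq_bigr do rewrite galg_mulE mulr_suml.
rewrite [RHS]exchange_big /=; apply: eq_bigr => h _.
rewrite (reindex_inj (mulgI h^-1%g)) /=; apply: eq_bigr => k _.
by rewrite mulrA invMg invgK -!mulgA mulKVg.
Qed.

Lemma galg_mul1l : left_id (gelt 1) galg_mul.
Proof.
move=> x; apply/ffunP=> g; rewrite galg_mulE (bigD1 1%g) //= big1 => [|h nt_h].
  by rewrite ffunE eqxx mul1r addr0 invg1 mul1g.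
by rewrite ffunE (negPf nt_h) mul0r.
Qed.

Lemma galg_mul1r : right_id (gelt 1) galg_mul.
Proof.
move=> x; apply/ffunP=> g; rewrite galg_mulE (bigD1 g) //= big1 => [|h ne_hg].
  by rewrite ffunE mulVg eqxx mulr1 addr0.
by rewrite ffunE -eq_mulVg1 (negPf ne_hg) mulr0.
Qed.

Lemma galg_mulDl : left_distributive galg_mul +%R.
Proof.
move=> x y z; apply/ffunP=> g; rewrite !ffunE -big_split; apply: eq_bigr => h _.
by rewrite ffunE mulrDl.
Qed.

Lemma galg_mulDr : right_distributive galg_mul +%R.
Proof.
move=> x y z; apply/ffunP=> g; rewrite !ffunE -big_split; apply: eq_bigr => h _.
by rewrite ffunE mulrDr.
Qed.

Lemma gelt1_neq0 : gelt 1 != 0.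
Proof.
by apply/eqP=> /ffunP/(_ 1%g)/eqP; rewrite !ffunE eqxx oner_eq0.
Qed.

HB.instance Definition _ := GRing.Zmodule_isNzRing.Build A
  galg_mulA galg_mul1l galg_mul1r galg_mulDl galg_mulDr gelt1_neq0.

Definition galg_scale c x : A := [ffun g => c * x g].

Lemma galg_scaleA c d x : galg_scale c (galg_scale d x) = galg_scale (c * d) x.
Proof. by apply/ffunP=> g; rewrite !ffunE mulrA. Qed.

Lemma galg_scale1 : left_id 1 galg_scale.
Proof. by move=> x; apply/ffunP=> g; rewrite !ffunE mul1r. Qed.

Lemma galg_scaleDr : right_distributive galg_scale +%R.
Proof. by move=> c x y; apply/ffunP=> g; rewrite !ffunE mulrDr. Qed.

Lemma galg_scaleDl x : {morph galg_scale^~ x : c d / c + d}.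
Proof. by move=> c d; apply/ffunP=> g; rewrite !ffunE mulrDl. Qed.

HB.instance Definition _ := GRing.Zmodule_isLmodule.Build F A
  galg_scaleA galg_scale1 galg_scaleDr galg_scaleDl.

Lemma galg_scaleAl c x y : c *: (x * y) = c *: x * y.
Proof.
apply/ffunP=> g; rewrite !ffunE mulr_sumr; apply: eq_bigr => h _.
by rewrite ffunE mulrA.
Qed.

HB.instance Definition _ := GRing.Lmodule_isLalgebra.Build F A galg_scaleAl.

Lemma galg_scaleAr c x y : c *: (x * y) = x * (c *: y).
Proof.
apply/ffunP=> g; rewrite !ffunE mulr_sumr; apply: eq_bigr => h _.
by rewrite ffunE mulrCA.
Qed.

HB.instance Definition _ := GRing.Lalgebra_isAlgebra.Build F A galg_scaleAr.

Lemma galg_sum x : x = \sum_g x g *: gelt g.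
Proof.
apply/ffunP=> g; rewrite sum_ffunE (bigD1 g) //= big1 => [|h ne_hg].
  by rewrite !ffunE eqxx mulr1 addr0.
by rewrite !ffunE eq_sym (negPf ne_hg) mulr0.
Qed.

Lemma gelt1 : gelt 1 = 1.
Proof. by []. Qed.

Lemma geltM g h : gelt (g * h)%g = gelt g * gelt h.
Proof.
apply/ffunP=> k; rewrite !ffunE (bigD1 g) //= big1 => [|l ne_lg].
  by rewrite !ffunE eqxx mul1r addr0 -(inj_eq (mulgI g^-1%g)) mulKg.
by rewrite ffunE (negPf ne_lg) mul0r.
Qed.

Definition aug x : F := \sum_g x g.

Definition star x : A := [ffun g => x g^-1%g].

Lemma star_is_linear : linear star.
Proof. by move=> c x y; apply/ffunP=> g; rewrite !ffunE. Qed.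

HB.instance Definition _ :=
  GRing.isLinear.Build F A A *:%R star star_is_linear.

Lemma star_gelt g : star (gelt g) = gelt g^-1%g.
Proof. by apply/ffunP=> h; rewrite !ffunE -eq_invg_sym eq_sym. Qed.

Lemma star1 : star 1 = 1.
Proof. by rewrite -gelt1 star_gelt invg1. Qed.

Lemma starM x y : star (x * y) = star y * star x.
Proof.
apply/ffunP=> g; rewrite !ffunE.
rewrite (reindex_inj (mulgI g^-1%g)) /=; apply: eq_bigr => h _.
by rewrite !ffunE mulrC !invMg !invgK mulgK.
Qed.

Lemma aug1 : aug 1 = 1.
Proof.
rewrite /aug (bigD1 1%g) //= big1 => [|h nt_h]; first by rewrite ffunE eqxx addr0.
by rewrite ffunE (negPf nt_h).
Qed.

Lemma augM x y : aug (x * y) = aug x * aug y.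
Proof.
rewrite /aug mulr_suml; under eq_bigr do rewrite ffunE.
rewrite exchange_big; apply: eq_bigr => h _; rewrite -mulr_sumr.
by rewrite [in RHS](reindex_inj (mulgI h^-1%g)).
Qed.

End GroupAlgebra.

Section UnitaryUnits.

Variables (F : finFieldType) (gT : finGroupType).

HB.instance Definition _ := Finite.copy (galg F gT) {ffun gT -> F}.
HB.instance Definition _ := FinRing.isNzRing.Build (galg F gT).

(* A finite F makes FG a finite ring, so that its units form a finGroupType.  *)
Definition normalized_units : {set {unit galg F gT}} :=
  [set u | aug (val u) == 1].

Definition unitary_units : {set {unit galg F gT}} :=
  [set u in normalized_units | (val u)^-1 == star (val u)].

Lemma normalized_units_group_set : group_set normalized_units.
Proof.
apply/group_setP; split=> [|u v]; first by rewrite inE aug1.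
by rewrite !inE => /eqP u1 /eqP v1; rewrite augM u1 v1 mulr1.
Qed.

Canonical normalized_units_group := Group normalized_units_group_set.

Lemma unitary_units_group_set : group_set unitary_units.
Proof.
apply/group_setP; split=> [|u v].
  by rewrite inE group1 /= invr1 star1.
case/setIdP=> Vu /eqP u_uni /setIdP[Vv /eqP v_uni]; apply/setIdP.
by rewrite groupM //= starM -u_uni -v_uni invrM ?(valP u) ?(valP v).
Qed.

Canonical unitary_units_group := Group unitary_units_group_set.

End UnitaryUnits.

Section MaximalClass.

Variable gT : finGroupType.
Implicit Types (G : {set gT}) (n : nat).
Local Open Scope group_scope.

(* The library's commutator [~ a, b] is a^-1 * b^-1 * a * b.  G \isog Grp p    *)
(* compares G with the largest finite quotient of the group presented by p;   *)
(* the groups presented here are finite, so it says that G is that group.     *)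
Definition dihedral_pres n G :=
  G \isog Grp (a : b : a ^+ (2 ^ n), b ^+ 2, [~ a, b] = a ^- 2).

Definition quaternion_pres n G :=
  G \isog Grp (a : b :
    a ^+ (2 ^ n), b ^+ 2 = a ^+ (2 ^ n.-1), [~ a, b] = a ^- 2).

(* The exponent -2 + 2 ^ (n - 1) is split since Grp only takes exponents in   *)
(* nat.                                                                       *)
Definition semidihedral_pres n G :=
  G \isog Grp (a : b :
    a ^+ (2 ^ n), b ^+ 2, [~ a, b] = a ^- 2 * a ^+ (2 ^ n.-1)).

Definition maximal_class_2group G : Prop :=
  exists n : nat,
    [\/ (2 <= n)%N /\ dihedral_pres n G,
        (2 <= n)%N /\ quaternion_pres n G
      | (3 <= n)%N /\ semidihedral_pres n G].

End MaximalClass.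

(* Main.v *)
From HB Require Import structures.
Require Import Defs.
From mathcomp Require Import all_boot all_order all_algebra all_fingroup.
From mathcomp Require Import all_solvable.

Set Implicit Arguments.
Unset Strict Implicit.
Unset Printing Implicit Defensive.

Import GRing.Theory.
Local Open Scope ring_scope.

(** Write N = 2^n for the order of the cyclic maximal subgroup <a> of a 2-group
    of maximal class G, and C for the group algebra of <a>, a commutative ring.
    The unitary group turns out to know G through its order alone, except for
    one coincidence of orders.

    Every element of FG is x + y b with x, y in C.  Expanding
    (x + y b)(x + y b)^* = 1 gives a pair of equations inside C
    ([card_unitary_pairs]): with norm x = x x^*,
      norm x + norm y = 1   and   y t(x) + z x t(y) = 0,
    where t is the ring automorphism a |-> a of C in the dihedral and quaternion
    cases, a |-> a^(1 + N/2) in the semidihedral case, and z = a^(N/2) in the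
    quaternion case, z = 1 in the other two.  So for a fixed n the three
    families give three subsets of the same set C x C:
    - in characteristic 2 the second equation is void in the dihedral case, so
      the dihedral solutions contain all others;
    - in the quaternion case it says that (1 + z) x y = 0; one of x, y has
      augmentation 1 and is invertible, so the other one is fixed by z, and on
      such elements t is invisible: the quaternion solutions are semidihedral
      ([sub_unitary_pairs_twist]).
    For n >= 3 both inclusions are strict, by explicit solutions
    ([unitary_pairs_twist_proper], [unitary_pairs_id_proper]), so the three
    unitary groups have different orders.

    The order also determines n, since it lies between 2^N and 2^(2N), the upper
    bound being strict.  The upper bound is trivial.  For the lower bound it
    suffices to count quaternion solutions; these include the pairs formed by a
    unitary element of C and a multiple of 1 + z, and unitary elements are
    counted by the fibres of the norm, which takes few values because its values
    are symmetric ([unitary_pairs_lower]).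

    What remains is D_8 against Q_8, where the orders agree.  A unitary u with
    u^2 = 1 satisfies u = u^*.  In Q_8 an element is conjugate at most to itself
    and its inverse, so symmetric elements of the group algebra, in particular
    these involutions, are central; in D_8 the reflection b is a noncentral
    involution.

    The converse is functoriality of the unitary group in G. *)

(** * Pushing a group algebra forward along a group morphism *)

Section Pushforward.

Variables (F : fieldType) (gT hT : finGroupType) (f : gT -> hT).
Implicit Types (x y : galg F gT) (g : gT).

Definition galg_map x : galg F hT := \sum_g x g *: gelt F (f g).

Lemma galg_map_is_linear : linear galg_map.
Proof.
move=> c x y; rewrite /galg_map scaler_sumr -big_split.
apply: eq_bigr => g _ /=.
by rewrite !ffunE scalerDl scalerA.
Qed.

HB.instance Definition _ :=
  GRing.isLinear.Build F (galg F gT) (galg F hT) *:%R galg_map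
    galg_map_is_linear.

Lemma galg_map_gelt g : galg_map (gelt F g) = gelt F (f g).
Proof.
rewrite /galg_map (bigD1 g) //= big1 => [|h ne_hg].
  by rewrite ffunE eqxx scale1r addr0.
by rewrite ffunE (negPf ne_hg) scale0r.
Qed.

Lemma galg_map_coef x g : injective f -> galg_map x (f g) = x g.
Proof.
move=> f_inj; rewrite sum_ffunE (bigD1 g) //= big1 => [|h ne_hg].
  by rewrite !ffunE eqxx mulr1 addr0.
by rewrite !ffunE (inj_eq f_inj) eq_sym (negPf ne_hg) mulr0.
Qed.

Lemma galg_map_out x h : (forall g, f g != h) -> galg_map x h = 0.
Proof.
move=> f'h; rewrite sum_ffunE big1 // => g _.
by rewrite !ffunE eq_sym (negPf (f'h g)) mulr0.
Qed.

Hypothesis fM : {morph f : g h / (g * h)%g}.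

Lemma galg_mapM : {morph galg_map : x y / x * y}.
Proof.
move=> x y; rewrite {1}[x]galg_sum mulr_suml linear_sum [galg_map x]/galg_map.
rewrite mulr_suml; apply: eq_bigr => g _.
rewrite -!scalerAl linearZ /=; congr (_ *: _).
rewrite {1}[y]galg_sum mulr_sumr linear_sum [galg_map y]/galg_map mulr_sumr.
apply: eq_bigr => h _.
by rewrite -!scalerAr linearZ /= -!geltM galg_map_gelt fM.
Qed.

Lemma morph_fun1 : f 1%g = 1%g.
Proof. by apply: (mulgI (f 1%g)); rewrite -fM !mulg1. Qed.

Lemma morph_funV g : f g^-1%g = (f g)^-1%g.
Proof. by apply: (mulgI (f g)); rewrite -fM !mulgV morph_fun1. Qed.

Lemma galg_map1 : galg_map 1 = 1.
Proof. by rewrite -!gelt1 galg_map_gelt morph_fun1. Qed.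

Lemma galg_map_star x : galg_map (star x) = star (galg_map x).
Proof.
rewrite {1}[x]galg_sum 3!linear_sum.
apply: eq_bigr => g _.
by rewrite !linearZ /= !star_gelt galg_map_gelt morph_funV.
Qed.

End Pushforward.

Lemma galg_map_comp (F : fieldType) (gT hT kT : finGroupType)
    (f : gT -> hT) (f' : hT -> kT) (x : galg F gT) :
  galg_map f' (galg_map f x) = galg_map (f' \o f) x.
Proof.
rewrite [galg_map f x]/galg_map linear_sum; apply: eq_bigr => g _.
by rewrite linearZ /= galg_map_gelt.
Qed.

Lemma galg_map_eq_id (F : fieldType) (gT : finGroupType) (f : gT -> gT)
    (x : galg F gT) :
  f =1 id -> galg_map f x = x.
Proof.
by move=> fE; rewrite [RHS]galg_sum; apply: eq_bigr => g _; rewrite fE.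
Qed.

Lemma galg_map_inj (F : fieldType) (gT hT : finGroupType) (f : gT -> hT) :
  injective f -> injective (galg_map (F := F) f).
Proof.
move=> f_inj x y eq_xy; apply/ffunP=> g.
by rewrite -(galg_map_coef x g f_inj) eq_xy galg_map_coef.
Qed.

Lemma starK (F : fieldType) (gT : finGroupType) :
  involutive (@star F gT).
Proof. by move=> x; apply/ffunP=> g; rewrite !ffunE invgK. Qed.

Lemma aug_star (F : fieldType) (gT : finGroupType) (x : galg F gT) :
  aug (star x) = aug x.
Proof.
rewrite /aug (reindex_inj invg_inj) /=; apply: eq_bigr => g _.
by rewrite ffunE invgK.
Qed.

Lemma galg_addE (F : fieldType) (gT : finGroupType) (x y : galg F gT) g :
  (x + y) g = x g + y g.
Proof. by rewrite ffunE. Qed.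

Lemma galg_mul_gelt_coef (F : fieldType) (gT : finGroupType)
    (x : galg F gT) h g :
  (x * gelt F h) g = x (g * h^-1)%g.
Proof.
rewrite ffunE (bigD1 (g * h^-1)%g) //= big1 => [|k ne_k].
  by rewrite ffunE invMg invgK mulgKV eqxx mulr1 addr0.
rewrite ffunE -(inj_eq (mulgI k)) mulKVg -(inj_eq (mulIg h^-1%g)) mulgK eq_sym.
by rewrite (negPf ne_k) mulr0.
Qed.

Lemma aug_gelt (F : fieldType) (gT : finGroupType) (g : gT) :
  aug (gelt F g) = 1.
Proof.
rewrite /aug (bigD1 g) //= big1 => [|h ne_hg].
  by rewrite ffunE eqxx addr0.
by rewrite ffunE (negPf ne_hg).
Qed.

Lemma augD (F : fieldType) (gT : finGroupType) (x y : galg F gT) :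
  aug (x + y) = aug x + aug y.
Proof.
by rewrite /aug -big_split; apply: eq_bigr => g _; rewrite galg_addE.
Qed.

Lemma gelt_mul_coef (F : fieldType) (gT : finGroupType)
    (x : galg F gT) h g :
  (gelt F h * x) g = x (h^-1 * g)%g.
Proof.
rewrite ffunE (bigD1 h) //= big1 => [|k ne_k].
  by rewrite ffunE eqxx mul1r addr0.
by rewrite ffunE (negPf ne_k) mul0r.
Qed.

(** * The unitary equation and unitary units *)

Section UnitaryEquation.

Variables (F : finFieldType) (gT : finGroupType).
Implicit Types x y : galg F gT.

(** One-sided inverses are two-sided because the ring is finite. *)
Lemma galg_mul_eq1C x y : x * y = 1 -> y * x = 1.
Proof.
move=> xy1; have y_inj: injective ( *%R y).
  by move=> u v /(congr1 ( *%R x)) /=; rewrite !mulrA xy1 !mul1r.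
have /codomP[u yu1]: 1 \in codom ( *%R y) by apply: inj_card_onto.
suff ->: x = u by rewrite -yu1.
by rewrite -[x]mulr1 yu1 mulrA xy1 mul1r.
Qed.

Lemma galg_unitP x y : x * y = 1 -> x \is a GRing.unit.
Proof. by move=> xy; apply/unitrP; exists y; rewrite galg_mul_eq1C. Qed.

End UnitaryEquation.

Section TwoElementField.

Variable F : finFieldType.
Hypothesis oF : #|F| = 2%N.

Lemma F2_cases (c : F) : c = 0 \/ c = 1.
Proof.
have [-> | nz_c] := eqVneq c 0; first by left.
right; apply/eqP; apply: contraT => ne_c1.
have: uniq [:: 0; 1; c].
  by rewrite /= !inE !negb_or eq_sym oner_eq0 eq_sym nz_c eq_sym ne_c1.
by move/card_uniqP=> o3; have:= max_card [in [:: 0; 1; c]]; rewrite o3 oF.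
Qed.

Lemma F2_sqr (c : F) : c * c = c.
Proof. by case: (F2_cases c) => ->; rewrite ?mulr0 ?mulr1. Qed.

Lemma F2_addcc (c : F) : c + c = 0.
Proof.
case: (F2_cases c) => ->; first by rewrite addr0.
have [//|/eqP] := F2_cases (1 + 1).
by rewrite -subr_eq0 addrK oner_eq0.
Qed.

End TwoElementField.

Section UnitaryOverTwoElements.

Variables (F : finFieldType) (gT : finGroupType).
Hypothesis oF : #|F| = 2%N.
Local Notation A := (galg F gT).
Implicit Types x y : A.

Lemma galg_addxx x : x + x = 0.
Proof. by apply/ffunP=> g; rewrite !ffunE F2_addcc. Qed.

Lemma galg_opp x : - x = x.
Proof. by apply/esym/eqP; rewrite -addr_eq0 galg_addxx. Qed.

Lemma galg_addKr x y : x + (x + y) = y.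
Proof. by rewrite addrA galg_addxx add0r. Qed.

Lemma galg_eq_add0 x y : x + y = 0 -> x = y.
Proof. by move/eqP; rewrite addr_eq0 galg_opp => /eqP. Qed.

(** Over the two-element field the normalization is automatic: the augmentation
    of a solution squares to one. *)
Lemma unitary_unitsE (u : {unit A}) :
  (u \in unitary_units F gT) = (val u * star (val u) == 1).
Proof.
rewrite !inE; apply/idP/eqP=> [/andP[_ /eqP <-]|uu1].
  by rewrite divrr ?(valP u).
apply/andP; split.
  have /(congr1 (@aug _ _)) := uu1.
  by rewrite augM aug_star aug1 F2_sqr // => ->.
by rewrite -[star _]mul1r -[X in X * star _](mulVr (valP u)) -mulrA uu1 mulr1.
Qed.

Lemma card_unitary_units :
  #|unitary_units F gT| = #|[set x : A | x * star x == 1]|.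
Proof.
rewrite -(card_imset _ val_inj); apply: eq_card => x.
apply/imsetP/idP=> [[u Vu ->]|]; rewrite inE; first by rewrite -unitary_unitsE.
move/eqP=> xx1; exists (FinRing.unit _ (galg_unitP xx1)) => //.
by rewrite unitary_unitsE /= xx1.
Qed.

Lemma card_galg : #|{: A}| = (2 ^ #|gT|)%N.
Proof. by rewrite card_ffun oF. Qed.

Lemma unitary_units_lt : (#|unitary_units F gT| < 2 ^ #|gT|)%N.
Proof.
rewrite card_unitary_units -card_galg -cardsT; apply: proper_card.
rewrite properEneq subsetT andbT; apply/eqP => /setP/(_ 0).
by rewrite !inE mul0r eq_sym oner_eq0.
Qed.

End UnitaryOverTwoElements.

(** * Functoriality *)

Section UnitaryFunctor.

Variables (F : finFieldType) (gT hT : finGroupType) (f : gT -> hT).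
Hypothesis oF : #|F| = 2%N.
Hypotheses (f_inj : injective f) (fM : {morph f : g h / (g * h)%g}).

Lemma galg_map_unit (u : {unit galg F gT}) :
  galg_map f (val u) \is a GRing.unit.
Proof.
apply: (@galg_unitP _ _ _ (galg_map f (val u)^-1)).
by rewrite -galg_mapM // divrr ?(valP u) ?galg_map1.
Qed.

Definition unit_map u : {unit galg F hT} := FinRing.unit _ (galg_map_unit u).

Lemma unit_mapM : {in unitary_units F gT &, {morph unit_map : u v / (u * v)%g}}.
Proof. by move=> u v _ _; apply/val_inj; rewrite /= galg_mapM. Qed.

Canonical unit_map_morphism := Morphism unit_mapM.

Lemma unit_map_isog :
  exists2 K : {group {unit galg F hT}},
    unitary_units F gT \isog K & K \subset unitary_units F hT.
Proof.
exists (unit_map @* unitary_units F gT)%G.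
  apply: sub_isog => //; apply/injmP => u v _ _ /(congr1 val) /= eq_uv.
  exact/val_inj/(galg_map_inj f_inj).
apply/subsetP=> _ /morphimP[u _ Vu ->]; move: Vu; rewrite !unitary_unitsE //=.
by move/eqP=> uu1; rewrite -galg_map_star // -galg_mapM // uu1 galg_map1.
Qed.

End UnitaryFunctor.

Lemma isog_setT_fun (gT hT : finGroupType) :
  [set: gT] \isog [set: hT] ->
  exists2 f : gT -> hT, injective f & {morph f : g h / (g * h)%g}.
Proof.
case/isogP=> f /injmP f_inj _; exists f => [g h | g h].
  by apply: f_inj; rewrite inE.
by rewrite morphM ?inE.
Qed.

(** Injections in both directions suffice, because the groups are finite. *)
Lemma unitary_units_isog (F : finFieldType) (gT hT : finGroupType) :
  #|F| = 2%N ->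
  [set: gT] \isog [set: hT] ->
  unitary_units F gT \isog unitary_units F hT.
Proof.
move=> oF isoGH; have [f f_inj fM] := isog_setT_fun isoGH.
have [|f' f'_inj f'M] := @isog_setT_fun hT gT; first by rewrite isog_sym.
have [K isoK sKV] := unit_map_isog oF f_inj fM.
have [L isoL sLV] := unit_map_isog oF f'_inj f'M.
suff <-: K = unitary_units F hT :> {set _} by [].
apply/eqP; rewrite eqEcard sKV -(card_isog isoK) (card_isog isoL).
exact: subset_leq_card.
Qed.

(** * Commutative group algebras *)

Section AbelianGroupAlgebra.

Variables (F : finFieldType) (A : finGroupType).
Hypothesis oF : #|F| = 2%N.
Hypothesis abA : @commutative A A *%g.
Local Notation C := (galg F A).
Implicit Types (x y : C) (g h z : A).

Lemma galg_mulC x y : x * y = y * x.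
Proof.
apply/ffunP=> g; rewrite !ffunE.
have inj_h: injective (fun h => h^-1 * g)%g by move=> h k /mulIg/invg_inj.
rewrite [RHS](reindex_inj inj_h) /=; apply: eq_bigr => h _.
by rewrite invMg invgK (abA (g^-1 * h)%g) mulKVg mulrC.
Qed.

Lemma galg_sqrD x y : (x + y) * (x + y) = x * x + y * y.
Proof. by rewrite mulrDl !mulrDr (galg_mulC y x) -addrA (galg_addKr oF). Qed.

Lemma galg_frobeniusD x y k : (x + y) ^+ (2 ^ k) = x ^+ (2 ^ k) + y ^+ (2 ^ k).
Proof.
elim: k => [|k IHk]; first by rewrite !expr1.
by rewrite expnSr !exprM IHk !expr2 galg_sqrD.
Qed.

(** The Frobenius map raises the group elements to powers and fixes the
    coefficients, so in a commutative 2-group algebra a large power of an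
    element is its augmentation. *)
Lemma galg_frobenius x k :
  (forall g, g ^+ (2 ^ k) = 1)%g -> x ^+ (2 ^ k) = aug x *: 1.
Proof.
move=> expA; rewrite [in LHS](galg_sum x).
rewrite (big_morph (fun y => y ^+ (2 ^ k)) (fun x y => galg_frobeniusD x y k)
  (id1 := 0)); last by rewrite expr0n expn_eq0.
rewrite /aug scaler_suml; apply: eq_bigr => g _.
have gX m : gelt F g ^+ m = gelt F (g ^+ m).
  by elim: m => // m IHm; rewrite exprS expgS geltM IHm.
rewrite -[x g *: _]mulr_algl exprMn_comm; last exact: galg_mulC.
rewrite gX expA gelt1 mulr1.
case: (F2_cases oF (x g)) => ->; rewrite ?scale1r ?expr1n //.
by rewrite scale0r expr0n expn_eq0.
Qed.

Lemma aug1_inverse x k :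
  (forall g, g ^+ (2 ^ k) = 1)%g -> aug x = 1 -> exists y, x * y = 1.
Proof.
move=> expA x1; exists (x ^+ (2 ^ k).-1).
by rewrite -exprS prednK ?expn_gt0 // galg_frobenius // x1 scale1r.
Qed.

(** Unitary elements are those of norm 1.  On a commutative group algebra the
    norm is multiplicative, so its nonempty fibres in the unit group are cosets
    of the unitary group. *)
Definition norm x := x * star x.

Lemma normM x y : norm (x * y) = norm x * norm y.
Proof.
rewrite /norm starM -!mulrA; congr (x * _).
by rewrite mulrA galg_mulC.
Qed.

Lemma norm_star x : star (norm x) = norm x.
Proof. by rewrite /norm starM starK. Qed.

Lemma aug_norm x : aug (norm x) = aug x.
Proof. by rewrite augM aug_star (F2_sqr oF). Qed.

Lemma norm_coef1 x : norm x 1%g = aug x.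
Proof.
rewrite /norm ffunE; apply: eq_bigr => g _.
by rewrite ffunE mulg1 invgK (F2_sqr oF).
Qed.

End AbelianGroupAlgebra.

(** * Groups with an abelian subgroup of index two *)

Section IndexTwo.

Variables (F : finFieldType) (A : finGroupType).
Hypothesis oF : #|F| = 2%N.
Hypothesis abA : @commutative A A *%g.
Local Notation C := (galg F A).
Implicit Types (x y : C) (g h : A).

(** The A-component and the Ab-component of (x + y b)(x + y b)^* = 1 in the
    algebra of a group containing A with index two, where b^-1 g b = t(g)^-1 for
    g in A and b^-1 = z b. *)
Definition unitary_pairs (t : A -> A) (z : A) : {set C * C} :=
  [set p | (norm p.1 + norm p.2 == 1)
         & (p.2 * galg_map t p.1 + p.1 * gelt F z * galg_map t p.2 == 0)].

Variables (gT : finGroupType) (f : A -> gT) (b : gT) (t : A -> A) (z : A).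
Hypotheses (f_inj : injective f) (fM : {morph f : g h / (g * h)%g}).
Hypothesis tM : {morph t : g h / (g * h)%g}.
Hypotheses (fb : forall g, (f g ^ b)%g = (f (t g))^-1%g).
Hypotheses (Vb : b^-1%g = (f z * b)%g) (f'b : forall g, f g != b).
Hypothesis oG : #|gT| = (#|A|).*2.

Local Notation phi := (galg_map f).
Let join (p : C * C) : galg F gT := phi p.1 + phi p.2 * gelt F b.

Lemma join_inj : injective join.
Proof.
have f'bV g h : f h != (f g * b^-1)%g.
  apply/eqP=> eq_f; have /eqP[] := f'b (h^-1 * g)%g.
  by rewrite fM (morph_funV fM) eq_f invMg invgK mulgKV.
have f'bM g h : f h != (f g * b)%g.
  apply/eqP=> eq_f; have /eqP[] := f'b (g^-1 * h)%g.
  by rewrite fM (morph_funV fM) eq_f mulKg.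
move=> [x y] [x' y'] /ffunP eq_xy; congr (_, _); apply/ffunP=> g.
  have:= eq_xy (f g); rewrite !galg_addE !galg_mul_gelt_coef /=.
  by rewrite !(galg_map_coef _ _ f_inj) !(galg_map_out _ (f'bV g)) !addr0.
have:= eq_xy (f g * b)%g; rewrite !galg_addE !galg_mul_gelt_coef /= mulgK.
by rewrite !(galg_map_coef _ _ f_inj) !(galg_map_out _ (f'bM g)) !add0r.
Qed.

Lemma gelt_conj x :
  gelt F b * phi x = phi (star (galg_map t x)) * gelt F b.
Proof.
have bfV g : (f g ^ b^-1)%g = (f (t g))^-1%g.
  rewrite Vb conjgM -fb; congr (_ ^ _)%g.
  by rewrite conjgE -fM abA fM mulKg.
rewrite [x in LHS]galg_sum -galg_map_star // galg_map_comp.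
rewrite [X in _ = X * _]/galg_map mulr_suml linear_sum mulr_sumr.
rewrite [RHS](reindex_inj invg_inj) /=; apply: eq_bigr => g _.
rewrite linearZ /= galg_map_gelt ffunE invgK -scalerAl -scalerAr -!geltM.
rewrite (morph_funV tM) (morph_funV fM) -bfV conjgE invgK.
by rewrite -!mulgA mulVg mulg1.
Qed.

Lemma join_unitary p :
  (join p * star (join p) == 1) = (p \in unitary_pairs t z).
Proof.
case: p => x y; set u := y * galg_map t x + x * gelt F z * galg_map t y.
have phi0 := raddf0 phi.
have ->: 1 = join (1, 0) by rewrite /join /= phi0 mul0r addr0 galg_map1.
suff ->: join (x, y) * star (join (x, y)) = join (norm x + norm y, u).
  by rewrite (inj_eq join_inj) inE -/u.
have conjE v w :
    phi v * gelt F b * phi (star w) = phi (v * galg_map t w) * gelt F b.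
  by rewrite -mulrA gelt_conj -galg_map_star // starK mulrA -galg_mapM.
have yb_x := conjE y x.
have x_yb : phi x * (gelt F b^-1%g * phi (star y))
    = phi (x * gelt F z * galg_map t y) * gelt F b.
  by rewrite -conjE Vb geltM !mulrA galg_mapM // galg_map_gelt.
have yb_yb : phi y * gelt F b * (gelt F b^-1%g * phi (star y)) = phi (norm y).
  by rewrite -mulrA (mulrA (gelt F b)) -geltM mulgV gelt1 mul1r -galg_mapM.
rewrite /join /= [star _]linearD /= starM star_gelt -!galg_map_star //.
rewrite mulrDl !mulrDr yb_x x_yb yb_yb -galg_mapM // -/(norm x).
rewrite /u !linearD /= mulrDl -!addrA; congr (_ + _).
by rewrite addrA addrC; congr (_ + _); apply: addrC.
Qed.

Lemma card_unitary_pairs :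
  #|unitary_units F gT| = #|unitary_pairs t z|.
Proof.
have join_bij : bijective join.
  apply: inj_card_bij; first exact: join_inj.
  by rewrite card_prod !card_galg // oG -addnn expnD.
rewrite card_unitary_units //.
rewrite -(on_card_preimset (f := join)); last exact: onW_bij.
by apply: eq_card => p; rewrite -join_unitary !inE.
Qed.

End IndexTwo.

(** * Comparing and bounding the solution sets *)

Section UnitaryPairs.

Variables (F : finFieldType) (A : finGroupType).
Hypotheses (oF : #|F| = 2%N) (abA : @commutative A A *%g).
Local Notation C := (galg F A).
Implicit Types (x y : C) (c g h : A) (t : A -> A).

Variable k : nat.
Hypothesis expA : forall g, (g ^+ (2 ^ k) = 1)%g.

Let mulC := galg_mulC (F := F) abA.
Let addxx := galg_addxx (gT := A) oF.

(** Without twist and correction the second condition reads y x + x y = 0, which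
    holds in characteristic 2. *)
Lemma unitary_pairs_id1 x y :
  ((x, y) \in unitary_pairs F id 1%g) = (norm x + norm y == 1).
Proof.
by rewrite inE /= !galg_map_eq_id // gelt1 mulr1 mulC addxx eqxx andbT.
Qed.

Lemma sub_unitary_pairs_id1 t z :
  unitary_pairs F t z \subset unitary_pairs F id 1%g.
Proof.
by apply/subsetP=> -[x y]; rewrite unitary_pairs_id1 inE => /andP[].
Qed.

Lemma unitary_pair_aug x y :
  norm x + norm y = 1 -> aug x = 1 \/ aug y = 1.
Proof.
move/(congr1 (@aug F A)); rewrite aug1 augD !aug_norm //.
by case: (F2_cases oF (aug x)) => ->; [rewrite add0r; right | left].
Qed.

Section Involution.

Variable z : A.
Hypothesis z2 : (z * z = 1)%g.

Lemma annihilator_coef y g : y * gelt F z = y -> y (g * z)%g = y g.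
Proof. by move=> yz; rewrite -{1}yz galg_mul_gelt_coef mulgK. Qed.

(** The second condition is (1 + z) x y = 0, and the member of the pair with
    augmentation 1 can be cancelled from it. *)
Lemma unitary_pairs_id_annihilator x y :
  (x, y) \in unitary_pairs F id z ->
  x * gelt F z = x \/ y * gelt F z = y.
Proof.
have cancel_unit u v :
    aug u = 1 -> v * u + u * gelt F z * v = 0 -> v * gelt F z = v.
  move=> u1 uv0; have [u' uu'] := aug1_inverse oF abA expA u1.
  have:= congr1 ( *%R u') (galg_eq_add0 oF uv0).
  by rewrite (mulC v) !mulrA (mulC u') uu' !mul1r mulC => <-.
rewrite inE /= !galg_map_eq_id // => /andP[/eqP Nxy /eqP xy0].
case: (unitary_pair_aug Nxy) => [x1 | y1]; [right | left].
  exact: cancel_unit xy0.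
apply: (cancel_unit y) => //.
by rewrite (mulC x) -(mulrA y) (mulC (gelt F z)) (mulC y (_ * _)).
Qed.

Variable t : A -> A.
Hypotheses (t_inj : injective t) (tz : forall g, t g = g \/ t g = (g * z)%g).

Lemma annihilator_twist x y : y * gelt F z = y -> y * galg_map t x = y * x.
Proof.
move=> yz; rewrite [x in RHS]galg_sum /galg_map !mulr_sumr.
apply: eq_bigr => g _; rewrite -!scalerAr; congr (_ *: _).
by case: (tz g) => ->; rewrite // abA geltM mulrA yz.
Qed.

Lemma annihilator_fixed y : y * gelt F z = y -> galg_map t y = y.
Proof.
move=> yz; apply/ffunP=> h.
have /codomP[g ->]: h \in codom t by apply: inj_card_onto.
by rewrite galg_map_coef //; case: (tz g) => ->; rewrite ?annihilator_coef.
Qed.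

(** One member of a solution for (id, z) is fixed by z.  The twist fixes that
    member, and does not change the product of the other one by it. *)
Lemma sub_unitary_pairs_twist :
  unitary_pairs F id z \subset unitary_pairs F t 1%g.
Proof.
apply/subsetP=> -[x y] xyP; have ann := unitary_pairs_id_annihilator xyP.
move: xyP; rewrite !inE /= => /andP[-> _]; apply/eqP; rewrite gelt1 mulr1.
case: ann => [xz | yz].
  by rewrite annihilator_fixed // annihilator_twist // mulC addxx.
by rewrite annihilator_twist // annihilator_fixed // mulC addxx.
Qed.

Lemma card_aug1 : (2 ^ #|A| <= 2 * #|[set x : C | aug x == 1%R]|)%N.
Proof.
set V := [set x | _].
rewrite -(card_galg A oF) -(cardsC V) mul2n -addnn leq_add2l.
(* adding 1 exchanges the two values of the augmentation *)
rewrite -(card_imset (mem (~: V)) (addrI 1)); apply/subset_leq_card/subsetP.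
move=> _ /imsetP[x nx1 ->]; move: nx1; rewrite !inE augD aug1.
by case: (F2_cases oF (aug x)) => ->; rewrite ?eqxx // addr0.
Qed.

(** The norm of an element of augmentation 1 is symmetric with coefficient 1 at
    the identity, so it is determined by its coefficients on a set S that meets
    every pair g, g^-1 of other elements.  There are thus at most 2^|S| norms,
    and each is reached by a coset of the unitary group. *)
Lemma card_aug1_le_unitary (S : {set A}) :
    (forall g, [|| g == 1%g, g \in S | g^-1%g \in S]) ->
  (#|[set x : C | aug x == 1%R]|
     <= 2 ^ #|S| * #|[set u : C | norm u == 1%R]|)%N.
Proof.
move=> S_cover; set V := [set x | _]; set U := [set u | _].
rewrite -card_powerset; pose s x := [set g in S | norm x g == 1].
have sV x : x \in V -> s x \in powerset S.
  by move=> _; rewrite inE; apply/subsetP=> g /setIdP[].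
rewrite -sum1_card (partition_big s _ sV) /= -sum_nat_const.
apply: leq_sum => B _; rewrite sum1_card.
have [v /andP[Vv /eqP sv] | none] := pickP (fun x => (x \in V) && (s x == B));
  last by rewrite eq_card0.
have [v' vv'] : exists v', v * v' = 1.
  by apply: (aug1_inverse oF abA expA); move: Vv; rewrite inE => /eqP.
have inj_v' : injective ( *%R v').
  by move=> x y /(congr1 ( *%R v)) /=; rewrite !mulrA vv' !mul1r.
rewrite -(card_imset _ inj_v'); apply/subset_leq_card/subsetP.
move=> _ /imsetP[x xP ->].
have /andP[Vx /eqP sx] : (x \in V) && (s x == B) := xP.
rewrite inE normM //.
suff ->: norm x = norm v by rewrite -normM // mulC vv' /norm star1 mulr1.
have eqS g : g \in S -> norm x g = norm v g.
  move=> Sg; have /setP/(_ g) := etrans sx (esym sv); rewrite !inE Sg /=.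
  case: (F2_cases oF (norm x g)) => ->;
  by case: (F2_cases oF (norm v g)) => ->; rewrite // eqxx eq_sym oner_eq0.
apply/ffunP=> g; have /or3P[/eqP-> | /eqS // | Sg] := S_cover g.
  by rewrite !norm_coef1 //; move: Vx Vv; rewrite !inE => /eqP-> /eqP->.
by rewrite -norm_star -[norm v]norm_star [LHS]ffunE [RHS]ffunE eqS.
Qed.

(** The elements (1 + z) w with w supported on D are distinct, and have norm
    (1 + z)^2 norm w = 0. *)
Lemma card_annihilator (D : {set A}) :
    {in D, forall g, (g * z)%g \notin D} ->
  (2 ^ #|D|
    <= #|[set y : C | (y * gelt F z == y)%R & norm y == 0%R]|)%N.
Proof.
move=> Dz; set E := [set y | _].
have Vz : (z^-1 = z)%g by apply/eqP; rewrite eq_invg_mul z2.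
rewrite -card_powerset.
pose chi (B : {set A}) : C := [ffun g => (g \in B)%:R].
pose e B := chi B + chi B * gelt F z.
have e_inj : {in powerset D &, injective e}.
  move=> B B'; rewrite !inE => sBD sB'D /ffunP eq_e; apply/setP=> g.
  have eD (B1 : {set A}) : B1 \subset D -> g \in D -> e B1 g = (g \in B1)%:R.
    move=> sB1 Dg; rewrite galg_addE galg_mul_gelt_coef !ffunE Vz.
    by rewrite (contraNF (subsetP sB1 (g * z)%g) (Dz g Dg)) addr0.
  have [Dg | nDg] := boolP (g \in D); last first.
    by rewrite !(contraNF (subsetP _ g) nDg).
  have:= eq_e g; rewrite !eD //; do 2!case: (g \in _) => //.
    by move/eqP; rewrite oner_eq0.
  by move/eqP; rewrite eq_sym oner_eq0.
rewrite -(card_in_imset e_inj); apply/subset_leq_card/subsetP.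
move=> _ /imsetP[B _ ->].
have zz : gelt F z * gelt F z = 1 by rewrite -geltM z2.
have eE : e B = chi B * (1 + gelt F z) by rewrite /e mulrDr mulr1.
rewrite inE; apply/andP; split.
  by rewrite /e mulrDl -mulrA zz mulr1 addrC.
rewrite eE normM // [norm (1 + _)]/norm linearD /= star1 star_gelt Vz.
by rewrite (galg_sqrD oF abA) zz mulr1 addxx mulr0.
Qed.

(** A unitary element of C and an element of norm 0 fixed by z form a solution
    for (id, z), in either order.  The intended D picks one element from each
    coset of {1, z}, and S one from each pair of inverse elements. *)
Lemma unitary_pairs_lower (D S : {set A}) :
    {in D, forall g, (g * z)%g \notin D} ->
    (forall g, [|| g == 1%g, g \in S | g^-1%g \in S]) ->
    #|S| = #|D| ->
  (2 ^ #|A| <= #|unitary_pairs F id z|)%N.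
Proof.
move=> Dz S_cover oSD.
have oU := card_aug1_le_unitary S_cover; have oE := card_annihilator Dz.
set U := [set u : C | norm u == 1] in oU.
set E := [set y | _ & _] in oE.
have sub : setX U E :|: setX E U \subset unitary_pairs F id z.
  apply/subsetP=> -[x y]; rewrite !inE /= !galg_map_eq_id //.
  case/orP=> [/and3P[/eqP Nx /eqP yz /eqP Ny] |].
    rewrite Nx Ny addr0 eqxx -(mulrA x) (mulC (gelt F z)) yz.
    by rewrite (mulC y) addxx /=.
  case/andP=> /andP[/eqP xz /eqP Nx] /eqP Ny.
  by rewrite Nx Ny add0r eqxx xz mulC addxx /=.
have disj : [disjoint setX U E & setX E U].
  rewrite -setI_eq0; apply/eqP/setP=> -[x y]; rewrite !inE /=.
  apply/negP=> /andP[/andP[/eqP Nx _] /andP[/andP[_ /eqP]]].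
  by rewrite Nx => /eqP; rewrite oner_eq0.
apply: leq_trans (subset_leq_card sub); rewrite cardsU disjoint_setI0 // cards0.
rewrite subn0 !cardsX [(#|E| * _)%N]mulnC addnn -mul2n.
apply: leq_trans card_aug1 _; rewrite leq_mul2l /=; apply: leq_trans oU _.
by rewrite mulnC leq_mul2l oSD oE orbT.
Qed.

End Involution.

Lemma norm_1Dc2 c :
  norm (1 + gelt F (c ^+ 2)) = gelt F (c ^+ 2) + gelt F (c ^- 2).
Proof.
rewrite /norm linearD /= star1 star_gelt mulrDl !mulrDr !mulr1 mul1r.
rewrite -geltM mulgV gelt1 [1 + gelt F _]addrC addrACA addxx.
by rewrite addr0 addrC.
Qed.

(** This makes (1 + c + c^2, 1 + c^2) a solution of norm x + norm y = 1. *)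
Lemma norm_1DcDc2 c :
  norm (1 + gelt F c + gelt F (c ^+ 2)) = 1 + norm (1 + gelt F (c ^+ 2)).
Proof.
rewrite norm_1Dc2; set x := 1 + _ + _.
(* x is palindromic in c, so its norm is x^2 c^-2 *)
have sx : star x = x * gelt F (c ^- 2).
  rewrite /x !linearD /= star1 !star_gelt !mulrDl mul1r -!geltM mulgV -gelt1.
  by rewrite expgS expg1 invMg mulKVg addrAC [RHS]addrC addrA.
rewrite /norm sx mulrA /x !(galg_sqrD oF abA) mulr1 -!geltM !mulrDl mul1r.
rewrite -!geltM.
have cc : (c * c = c ^+ 2)%g by [].
rewrite cc mulgV mulgK gelt1.
by rewrite [gelt F _ + 1]addrC -addrA [X in _ + X]addrC.
Qed.

Section Witnesses.

Variables (t : A -> A) (z : A).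
Hypothesis tM : {morph t : g h / (g * h)%g}.

(** The pair (1 + c + c^2, 1 + c^2) fails the twisted condition by
    (1 + c^2) (c + c z), which is nonzero at c. *)
Lemma unitary_pairs_twist_proper c :
    t c = (c * z)%g -> t (c ^+ 2)%g = (c ^+ 2)%g ->
    (c ^+ 2 != 1)%g -> (z != 1)%g -> (c ^+ 2 * z != 1)%g ->
  unitary_pairs F t 1%g \proper unitary_pairs F id 1%g.
Proof.
move=> tc tc2 c2 z1 c2z; apply/properP; split.
  exact: sub_unitary_pairs_id1.
pose y : C := 1 + gelt F (c ^+ 2)%g.
exists (1 + gelt F c + gelt F (c ^+ 2)%g, y).
  by rewrite unitary_pairs_id1 norm_1DcDc2 -addrA addxx addr0.
rewrite inE negb_and; apply/orP; right; rewrite /= gelt1 mulr1.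
rewrite /y !linearD /= galg_map1 // !galg_map_gelt tc tc2 -/y.
rewrite [X in _ + X]mulC -mulrDr addrACA addxx addr0 addrACA addxx add0r.
rewrite /y mulrDl mul1r mulrDr -!geltM; apply/eqP=> /ffunP/(_ c).
rewrite !galg_addE !ffunE eqxx.
have [-> -> ->] : [/\ (c == c * z)%g = false, (c == c ^+ 2 * (c * z))%g = false
    & (c == c ^+ 2 * c)%g = false].
  have neq_cM g : (g != 1)%g -> (c == c * g)%g = false.
    by move=> g1; rewrite eq_mulVg1 mulKg (negPf g1).
  by rewrite mulgA (abA (c ^+ 2)%g c) -mulgA !neq_cM.
by rewrite !addr0 add0r => /eqP; rewrite oner_eq0.
Qed.

(** The pair is (x, x v) with v = 1 + c^2 and x = 1 + c + c^2, hence
    norm x = 1 + norm v.  Then norm x + norm (x v) = (1 + norm v)^2, which is 1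
    because norm v = c^2 + c^-2 has square z + z^-1 = 0.  The twisted condition
    holds because t fixes v.  Neither x nor v is fixed by z, as the coefficients
    at 1 and z differ, so the pair is no solution for (id, z). *)
Lemma unitary_pairs_id_proper c :
    (z * z = 1)%g -> injective t -> (forall g, t g = g \/ t g = (g * z)%g) ->
    #[c]%g = 8 -> (c ^+ 4 = z)%g -> t (c ^+ 2)%g = (c ^+ 2)%g ->
  unitary_pairs F id z \proper unitary_pairs F t 1%g.
Proof.
move=> z2 t_inj tz oc c4 tc2; apply/properP; split.
  exact: sub_unitary_pairs_twist.
have neq_cX i j : (i < 8)%N -> (j < 8)%N -> (c ^+ i == c ^+ j)%g = (i == j).
  by move=> lt_i lt_j; rewrite eq_expg_mod_order oc !modn_small.
pose v : C := 1 + gelt F (c ^+ 2)%g.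
pose x : C := 1 + gelt F c + gelt F (c ^+ 2)%g.
have z_neq i : (i < 8)%N -> (z == c ^+ i)%g = (4 == i).
  by move=> lt_i; rewrite -c4 neq_cX.
have c_eq1 : [/\ (1 == c)%g = false, (1 == c ^+ 2)%g = false,
    (z == 1)%g = false, (z == c)%g = false & (z == c ^+ 2)%g = false].
  by rewrite (neq_cX 0 1) // (neq_cX 0 2) // (z_neq 0) // (z_neq 1) // z_neq.
have [x' xx'] : exists x', x * x' = 1.
  apply: (aug1_inverse oF abA expA).
  by rewrite !augD aug1 !aug_gelt -addrA (F2_addcc oF) addr0.
exists (x, x * v).
  rewrite inE /=; apply/andP; split.
    rewrite normM // -{1}[norm x]mulr1 -mulrDr norm_1DcDc2 -/v.
    rewrite (galg_sqrD oF abA) mulr1 norm_1Dc2 (galg_sqrD oF abA).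
    rewrite -!geltM -invMg -expgD c4.
    have ->: (z^-1 = z)%g by apply/eqP; rewrite eq_invg_mul z2.
    by rewrite addxx addr0.
  have tv : galg_map t v = v.
    by rewrite linearD /= galg_map1 // galg_map_gelt tc2.
  rewrite galg_mapM // tv gelt1 mulr1 -mulrA (mulC v) [X in _ + X]mulrA.
  by rewrite -(mulrA x) addxx.
apply/negP=> /unitary_pairs_id_annihilator; case=> [xz | xvz].
  have := annihilator_coef 1%g xz; rewrite mul1g !galg_addE !ffunE.
  case: c_eq1 => -> -> -> -> ->; rewrite eqxx !addr0 => /esym/eqP.
  by rewrite oner_eq0.
have vz : v * gelt F z = v.
  by rewrite -[v]mul1r -xx' (mulC x) -!mulrA (mulrA x) xvz.
have := annihilator_coef 1%g vz; rewrite mul1g !galg_addE !ffunE.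
case: c_eq1 => _ -> -> _ ->; rewrite eqxx !addr0 => /esym/eqP.
by rewrite oner_eq0.
Qed.

End Witnesses.

End UnitaryPairs.

(** * The cyclic group of order 2^n *)

Section CyclicModel.

Variables (F : finFieldType) (n : nat).
Hypotheses (oF : #|F| = 2%N) (n_gt1 : (1 < n)%N).
Local Notation A := 'Z_(2 ^ n).
Implicit Types g h : A.

(** The cyclic group is additive here: Zhalf is the involution a^(N/2), and
    Ztwist is the automorphism a |-> a^(1 + N/2). *)
Definition Zhalf : A := (2 ^ n.-1)%:R.
Definition Ztwist (g : A) : A := g + g * Zhalf.

Let N_gt1 : (1 < 2 ^ n)%N.
Proof. by rewrite -{1}(expn0 2) ltn_exp2l // ltnW. Qed.

Let oN : (2 ^ n = 2 * 2 ^ n.-1)%N.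
Proof. by rewrite -expnS prednK // ltnW. Qed.

Let ltN k : (k < 2 ^ n)%N = (k < 2 ^ n.-1 + 2 ^ n.-1)%N.
Proof. by rewrite oN mul2n addnn. Qed.

Let ltM : (2 ^ n.-1 < 2 ^ n)%N.
Proof. by rewrite ltN -[X in (X < _)%N]addn0 ltn_add2l expn_gt0. Qed.

Let N0 : (2 ^ n)%:R = 0 :> A.
Proof. exact: pchar_Zp. Qed.

Let abA : @commutative A A *%g.
Proof. by move=> g h; apply: addrC. Qed.

Lemma card_Z2n : #|A| = (2 ^ n)%N.
Proof. by rewrite card_ord Zp_cast. Qed.

Let expgE g k : (g ^+ k)%g = g * k%:R.
Proof.
elim: k => [|k IHk]; first by rewrite mulr0.
by rewrite expgS IHk -[LHS]/(g + g * k%:R) mulrS mulrDr mulr1.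
Qed.

Lemma expg_Z2n g : (g ^+ (2 ^ n) = 1)%g.
Proof. by rewrite expgE N0 mulr0. Qed.

Lemma Zhalf2 : (Zhalf * Zhalf = 1)%g.
Proof. by rewrite -[LHS]/(Zhalf + Zhalf) -natrD addnn -mul2n -oN N0. Qed.

Let val_natr k : (k < 2 ^ n)%N -> (k%:R : A) = k :> nat.
Proof. by move=> lt_k; rewrite val_Zp_nat // modn_small. Qed.

Lemma mulr_Zhalf g : g * Zhalf = if odd g then Zhalf else 0.
Proof.
rewrite -[g in LHS]natr_Zp -{1}[nat_of_ord g]odd_double_half natrD mulrDl.
have ->: (g./2.*2)%:R * Zhalf = 0.
  by rewrite -natrM -mul2n mulnAC -oN natrM N0 mul0r.
by rewrite addr0; case: odd; rewrite ?mul0r ?mul1r.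
Qed.

Lemma ZtwistM : {morph Ztwist : g h / (g * h)%g}.
Proof.
by move=> g h; rewrite -[LHS]/((g + h) + (g + h) * Zhalf) mulrDl addrACA.
Qed.

Lemma ZtwistE g : Ztwist g = g \/ Ztwist g = (g * Zhalf)%g.
Proof.
by rewrite /Ztwist mulr_Zhalf; case: odd; [right | left; rewrite addr0].
Qed.

Lemma Ztwist_inj : injective Ztwist.
Proof.
suff E : involutive Ztwist by apply: inv_inj.
move=> g; rewrite /Ztwist mulrDl -addrA -mulrA.
have ->: Zhalf * Zhalf = 0.
  rewrite mulr_Zhalf val_Zp_nat // odd_mod ?oN ?oddM // oddX -subn1 subn_eq0.
  by rewrite leqNgt n_gt1.
rewrite mulr0 addr0 -mulrDr (_ : Zhalf + Zhalf = 0) ?mulr0 ?addr0 //.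
exact: Zhalf2.
Qed.

(** The half-systems are 0 <= g < N/2 for the cosets of Zhalf, and 0 < g <= N/2
    for the pairs of opposite elements. *)
Lemma cyclic_pairs_lower :
  (2 ^ (2 ^ n) <= #|unitary_pairs F id Zhalf|)%N.
Proof.
rewrite -[X in (2 ^ X <= _)%N]card_Z2n.
pose D : {set A} := [set g : A | (g < 2 ^ n.-1)%N].
apply: (unitary_pairs_lower oF abA expg_Z2n Zhalf2 (D := D)
  (S := [set 1 + g | g in D])); last by rewrite card_imset //; apply: addrI.
  move=> g; rewrite !inE -leqNgt => lt_g.
  rewrite -[(g * _)%g]/(g + Zhalf) -[g in g + _]natr_Zp -natrD.
  by rewrite val_natr ?leq_addl // ltN ltn_add2r.
have memS k : (0 < k <= 2 ^ n.-1)%N -> (k%:R : A) \in [set 1 + g | g in D].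
  case: k => // k /= lt_k; rewrite -natr1 addrC imset_f // inE val_natr //.
  by apply: leq_trans lt_k _; rewrite oN leq_pmull.
move=> g; have [-> | g_n0] := eqVneq g 0; first by apply/orP; left.
have g_gt0 : (0 < g)%N by rewrite lt0n.
have [le_g | lt_g] := leqP g (2 ^ n.-1).
  by rewrite -[g]natr_Zp memS ?orbT // g_gt0.
have lt_gN : (g < 2 ^ n)%N.
  by have := ltn_ord g; rewrite [X in (_ < X)%N]Zp_cast.
have ->: (g^-1)%g = (2 ^ n - g)%:R.
  by rewrite natrB ?(ltnW lt_gN) // N0 sub0r natr_Zp.
rewrite memS ?orbT // subn_gt0 lt_gN leq_subLR.
by rewrite /= leqNgt ltN ltn_add2r -leqNgt ltnW.
Qed.

Lemma cyclic_pairs_id_twist :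
  unitary_pairs F id Zhalf \subset unitary_pairs F Ztwist 1%g.
Proof. exact: (sub_unitary_pairs_twist oF abA expg_Z2n Ztwist_inj ZtwistE). Qed.

Hypothesis n_gt2 : (2 < n)%N.

Lemma cyclic_pairs_twist_proper :
  unitary_pairs F Ztwist 1%g \proper unitary_pairs F id (1%g : A).
Proof.
have natr_neq0 k : (0 < k < 2 ^ n)%N -> (k%:R : A) != 0.
  by case/andP=> k0 lt_k; rewrite -val_eqE /= val_natr // -lt0n.
pose c : A := 1; have c2 : (c ^+ 2)%g = 2%:R by rewrite expgE mul1r.
have M4 : (4 <= 2 ^ n.-1)%N.
  by rewrite (leq_exp2l 2 n.-1 (ltnSn 1)) -ltnS prednK // ltnW.
have lt2M : (2 < 2 ^ n.-1)%N by apply: leq_trans M4.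
apply: (unitary_pairs_twist_proper oF abA ZtwistM (c := c)); rewrite ?c2.
- by rewrite /Ztwist mul1r.
- by rewrite /Ztwist mulr_Zhalf val_natr ?addr0 // ltN ltn_addl.
- by rewrite natr_neq0 // ltN ltn_addl.
- by rewrite natr_neq0 // expn_gt0.
rewrite -[(_ * _)%g]/(2%:R + Zhalf) -natrD natr_neq0 //.
by rewrite ltN ltn_add2r lt2M.
Qed.

Lemma cyclic_pairs_id_proper :
  unitary_pairs F id Zhalf \proper unitary_pairs F Ztwist 1%g.
Proof.
(* a^(N/8), an element of order 8 *)
pose c : A := (2 ^ (n - 3))%:R.
have cX i : (c ^+ i)%g = (2 ^ (n - 3) * i)%:R by rewrite expgE natrM.
have N8 : (2 ^ n = 2 ^ (n - 3) * 8)%N by rewrite -(expnD 2 (n - 3) 3) subnK.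
have M4 : (2 ^ n.-1 = 2 ^ (n - 3) * 4)%N.
  by apply/eqP; rewrite -(eqn_pmul2l (ltn0Sn 1)) -oN N8 mulnCA.
have c4 : (c ^+ 4)%g = Zhalf by rewrite cX /Zhalf M4.
apply: (unitary_pairs_id_proper oF abA expg_Z2n ZtwistM (c := c)).
- exact: Zhalf2.
- exact: Ztwist_inj.
- exact: ZtwistE.
- apply/eqP; rewrite eqn_dvd order_dvdn cX -N8 N0 eqxx /=.
  have: ~~ (#[c]%g %| 2 ^ 2)%N.
    by rewrite order_dvdn c4 -val_eqE /= val_natr ?expn_eq0.
  have /dvdn_pfactor : (#[c]%g %| 2 ^ 3)%N by rewrite order_dvdn cX -N8 N0.
  case=> // m le_m3 ->; rewrite (dvdn_Pexp2l m 2) // -ltnNge => lt_2m.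
  exact: (dvdn_exp2l 2 lt_2m).
- by [].
rewrite cX /Ztwist mulr_Zhalf val_natr.
  by rewrite oddM andbF addr0.
by rewrite N8 ltn_pmul2l ?expn_gt0.
Qed.

End CyclicModel.

(** * Generators of the 2-groups of maximal class *)

Section CyclicIndexTwo.

Variables (gT : finGroupType) (n : nat) (a b : gT).
Local Open Scope group_scope.

Hypothesis oG : #|gT| = (2 ^ n.+1)%N.
Hypotheses (defG : <[a]> <*> <[b]> = [set: gT]) (aN : a ^+ (2 ^ n) = 1).
Hypotheses (b2 : b ^+ 2 \in <[a]>) (ab : a ^ b \in <[a]>).

(** The product of <a> and <b> fills the group, so the order of a is at least
    |G| / |<b> : <b^2>|, which leaves no room for a smaller order of a. *)
Lemma cyclic_index2 : #[a] = (2 ^ n)%N /\ b \notin <[a]>.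
Proof.
have nab : <[b]> \subset 'N(<[a]>).
  by rewrite cycle_subG inE -cycleJ cycle_subG.
have oab : #|<[a]> * <[b]>| = (2 ^ n.+1)%N.
  by rewrite -norm_joinEr // defG cardsT oG.
have le_a : (#[a] <= 2 ^ n)%N.
  by rewrite dvdn_leq ?expn_gt0 // order_dvdn aN.
have le_b : (#[b] <= 2 * #[b ^+ 2])%N.
  have gcd_le2 : (gcdn #[b] 2 <= 2)%N by rewrite dvdn_leq ?dvdn_gcdr.
  rewrite orderXgcd -[X in (X <= _)%N](divnK (dvdn_gcdl #[b] 2)) mulnC.
  by rewrite leq_mul2r gcd_le2 orbT.
have le_ab : (#[b ^+ 2] <= #|<[a]> :&: <[b]>|)%N.
  by rewrite subset_leq_card // cycle_subG inE b2 mem_cycle.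
have oa : #[a] = (2 ^ n)%N.
  apply/eqP; rewrite eqn_leq le_a /= -(leq_pmul2r (order_gt0 b)).
  have := mul_cardG <[a]> <[b]>; rewrite oab -!orderE => ->.
  rewrite expnS mulnAC (mulnC (2 ^ n)%N) leq_mul2r.
  by apply/orP; right; apply: leq_trans le_b _; rewrite leq_mul2l le_ab.
split=> //; apply: contraL (leqnn (2 ^ n.+1)) => ba; rewrite -ltnNge -{1}oab.
have /mulGidPl-> : <[b]> \subset <[a]> by rewrite cycle_subG.
by rewrite -orderE oa ltn_exp2l.
Qed.

End CyclicIndexTwo.

(** Two presentations define the same group as soon as each group satisfies the
    relations of the other. *)
Lemma isoGrp_isog (gT rT : finGroupType) (G : {group gT}) (H : {group rT}) p q :
  (G \isog Grp p -> H \isog Grp q -> H \homg Grp p -> G \homg Grp q ->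
     G \isog H)%g.
Proof. by move=> Gp Hq; rewrite isogEhom Gp Hq => -> ->. Qed.

Section CommutatorRelations.

Variables (gT : finGroupType) (a b : gT).
Local Open Scope group_scope.

Lemma commg_invert : ([~ a, b] == a ^- 2) = (a ^ b == a^-1).
Proof.
rewrite commgEl -(inj_eq (mulgI a)) mulKVg; congr (_ == _).
by rewrite expgS expg1 invMg mulKVg.
Qed.

Lemma commg_semi k : (0 < k)%N ->
  ([~ a, b] == a ^- 2 * a ^+ k) = (a ^ b == a ^+ k.-1).
Proof.
move=> k_gt0; rewrite commgEl -(inj_eq (mulgI a)) mulKVg; congr (_ == _).
by rewrite expgS expg1 invMg -mulgA mulKVg -{1}(prednK k_gt0) expgS mulKg.
Qed.

End CommutatorRelations.

(** The commutator relation is equivalent to one for the conjugate of a by b,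
    and the group presented in that form has a known order. *)
Lemma dihedral_generators (gT : finGroupType) n :
    (1 < n)%N -> dihedral_pres n [set: gT] ->
  #|gT| = (2 ^ n.+1)%N /\ exists a b : gT,
    [/\ a ^+ (2 ^ n) = 1, b ^+ 2 = 1, a ^ b = a^-1
      & <[a]> <*> <[b]> = [set: gT]]%g.
Proof.
move=> n_gt1 isoG.
have /isoGrp_hom/existsP[[a b] /= /eqP[defG aN bb abE]] := isoG.
have ab : (a ^ b = a^-1)%g by apply/eqP; rewrite -commg_invert abE.
split; last by exists a, b.
rewrite -card_2dihedral ?ltnS ?(ltnW n_gt1) // -cardsT; apply: card_isog.
have isoD := @Grp_2dihedral n.+1 (ltnW n_gt1).
apply: (isoGrp_isog isoG isoD); last first.
  by apply/existsP; exists (a, b); rewrite /= defG aN bb ab.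
have /isoGrp_hom/existsP[[x y] /= /eqP[defD xN yy xy]] := isoD.
apply/existsP; exists (x, y); rewrite /= defD xN yy.
by have /eqP-> : [~ x, y]%g == (x ^- 2)%g by rewrite commg_invert xy.
Qed.

Lemma quaternion_generators (gT : finGroupType) n :
    (1 < n)%N -> quaternion_pres n [set: gT] ->
  #|gT| = (2 ^ n.+1)%N /\ exists a b : gT,
    [/\ a ^+ (2 ^ n) = 1, b ^+ 2 = a ^+ (2 ^ n.-1), a ^ b = a^-1
      & <[a]> <*> <[b]> = [set: gT]]%g.
Proof.
move=> n_gt1 isoG.
have /isoGrp_hom/existsP[[a b] /= /eqP[defG aN bb abE]] := isoG.
have ab : (a ^ b = a^-1)%g by apply/eqP; rewrite -commg_invert abE.
split; last by exists a, b.
have n1_gt2 : (2 < n.+1)%N by [].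
rewrite -(card_quaternion n1_gt2) -cardsT; apply: card_isog.
have isoQ := Grp_quaternion n1_gt2.
apply: (isoGrp_isog isoG isoQ); last first.
  by apply/existsP; exists (a, b); rewrite /= defG aN bb ab.
have /isoGrp_hom/existsP[[x y] /= /eqP[defQ xN yy xy]] := isoQ.
apply/existsP; exists (x, y); rewrite /= defQ xN yy.
by have /eqP-> : [~ x, y]%g == (x ^- 2)%g by rewrite commg_invert xy.
Qed.

Lemma semidihedral_generators (gT : finGroupType) n :
    (2 < n)%N -> semidihedral_pres n [set: gT] ->
  #|gT| = (2 ^ n.+1)%N /\ exists a b : gT,
    [/\ a ^+ (2 ^ n) = 1, b ^+ 2 = 1, a ^ b = a ^+ (2 ^ n.-1).-1
      & <[a]> <*> <[b]> = [set: gT]]%g.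
Proof.
move=> n_gt2 isoG.
have /isoGrp_hom/existsP[[a b] /= /eqP[defG aN bb abE]] := isoG.
have M_gt0 : (0 < 2 ^ n.-1)%N by rewrite expn_gt0.
have ab : (a ^ b = a ^+ (2 ^ n.-1).-1)%g.
  by apply/eqP; rewrite -commg_semi ?abE.
split; last by exists a, b.
have n1_gt3 : (3 < n.+1)%N by [].
rewrite -(card_semidihedral n1_gt3) -cardsT; apply: card_isog.
have isoSD := Grp_semidihedral n1_gt3.
apply: (isoGrp_isog isoG isoSD); last first.
  by apply/existsP; exists (a, b); rewrite /= defG aN bb ab.
have /isoGrp_hom/existsP[[x y] /= /eqP[defSD xN yy xy]] := isoSD.
apply/existsP; exists (x, y); rewrite /= defSD xN yy.
have /eqP-> : [~ x, y]%g == (x ^- 2 * x ^+ (2 ^ n.-1))%g.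
  by rewrite commg_semi ?xy.
by [].
Qed.

(** * Counting unitary units *)

Section CyclicCount.

Variables (F : finFieldType) (gT : finGroupType) (n : nat) (a b : gT).
Hypotheses (oF : #|F| = 2%N) (n_gt1 : (1 < n)%N) (oG : #|gT| = (2 ^ n.+1)%N).
Hypotheses (defG : (<[a]> <*> <[b]>)%g = [set: gT]) (aN : (a ^+ (2 ^ n) = 1)%g).

Let N_gt1 : (1 < 2 ^ n)%N.
Proof. by rewrite -{1}(expn0 2) ltn_exp2l // ltnW. Qed.

Lemma expg_natr k : (a ^+ (k%:R : 'Z_(2 ^ n)) = a ^+ k)%g.
Proof. by rewrite val_Zp_nat // expg_mod. Qed.

Lemma card_unitary_cyclic (t : 'Z_(2 ^ n) -> 'Z_(2 ^ n)) (z : 'Z_(2 ^ n)) :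
    {morph t : g h / (g * h)%g} ->
    (forall g : 'Z_(2 ^ n), (a ^+ g) ^ b = (a ^+ (t g))^-1)%g ->
    (b^-1 = a ^+ z * b)%g ->
  #|unitary_units F gT| = #|unitary_pairs F t z|.
Proof.
move=> tM fb Vb.
have ab : (a ^ b \in <[a]>)%g.
  have := fb 1; rewrite -[1]/(1%:R) !expg_natr expg1 => ->.
  by rewrite groupV mem_cycle.
have b2 : (b ^+ 2 \in <[a]>)%g.
  by rewrite -groupV expgS expg1 invMg {1}Vb mulgK mem_cycle.
have [oa nab] := cyclic_index2 oG defG aN b2 ab.
have abA : commutative (@mul 'Z_(2 ^ n)) by move=> g h; apply: addrC.
apply: (card_unitary_pairs oF abA (f := fun g : 'Z_(2 ^ n) => (a ^+ g)%g)
  _ _ tM fb Vb).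
- move=> g h /eqP; rewrite eq_expg_mod_order oa.
  have lt_N (k : 'Z_(2 ^ n)) : (k < 2 ^ n)%N.
    by have := ltn_ord k; rewrite [X in (_ < X)%N]Zp_cast.
  by rewrite !modn_small // => /eqP /val_inj.
- by move=> g h /=; rewrite expgD_Zp ?expn_gt0 ?oa.
- by move=> g; apply: contraNneq nab => <-; apply: mem_cycle.
by rewrite oG card_ord Zp_cast // expnS mul2n.
Qed.

End CyclicCount.

Section Counts.

Variables (F : finFieldType) (gT : finGroupType) (n : nat).
Hypothesis oF : #|F| = 2%N.

Lemma card_unitary_dihedral :
    (1 < n)%N -> dihedral_pres n [set: gT] ->
  #|unitary_units F gT| = #|unitary_pairs F id (1%g : 'Z_(2 ^ n))|.
Proof.
move=> n_gt1 /(dihedral_generators n_gt1)[oG [a [b [aN bb ab defG]]]].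
apply: (card_unitary_cyclic oF n_gt1 oG defG aN) => // [g|].
  by rewrite conjXg ab expgVn.
by rewrite mul1g; apply/eqP; rewrite eq_invg_mul -bb.
Qed.

Lemma card_unitary_quaternion :
    (1 < n)%N -> quaternion_pres n [set: gT] ->
  #|unitary_units F gT| = #|unitary_pairs F id (Zhalf n)|.
Proof.
move=> n_gt1 /(quaternion_generators n_gt1)[oG [a [b [aN bb ab defG]]]].
apply: (card_unitary_cyclic oF n_gt1 oG defG aN) => // [g|].
  by rewrite conjXg ab expgVn.
rewrite /Zhalf expg_natr // -bb; apply/eqP; rewrite eq_invg_mul -expgSr -expgS.
by rewrite (expgM b 2 2) bb -expgM -expnSr prednK ?aN // ltnW.
Qed.

Lemma card_unitary_semidihedral :
    (2 < n)%N -> semidihedral_pres n [set: gT] ->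
  #|unitary_units F gT| = #|unitary_pairs F (@Ztwist n) 1%g|.
Proof.
move=> n_gt2 /(semidihedral_generators n_gt2)[oG [a [b [aN bb ab defG]]]].
have n_gt1 := ltnW n_gt2.
have N_gt1 : (1 < 2 ^ n)%N by rewrite -{1}(expn0 2) ltn_exp2l // ltnW.
apply: (card_unitary_cyclic oF n_gt1 oG defG aN) => // [||].
- exact: ZtwistM.
- move=> g; have ->: Ztwist g = (g * (2 ^ n.-1).+1)%:R.
    by rewrite mulnS natrD natrM natr_Zp.
  rewrite expg_natr // conjXg ab mulnC expgM -expgVn; congr (_ ^+ _)%g.
  apply/eqP; rewrite eq_sym eq_invg_mul -expgD addSnnS prednK ?expn_gt0 //.
  by rewrite addnn -mul2n -expnS prednK ?aN // ltnW.
by rewrite mul1g; apply/eqP; rewrite eq_invg_mul -bb.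
Qed.

End Counts.

(** * Central involutions and the groups of order 8 *)

Definition central_involutions (gT : finGroupType) (V : {set gT}) :=
  {in V &, forall u v : gT, (u * u = 1 -> u * v = v * u)%g}.

Lemma isog_central_involutions (gT hT : finGroupType)
    (G : {group gT}) (H : {group hT}) :
  G \isog H -> central_involutions H -> central_involutions G.
Proof.
case/isogP=> f /injmP f_inj fG cH u v Gu Gv u2.
apply: f_inj; rewrite ?groupM // !morphM //.
by apply: cH; rewrite -?morphM ?u2 ?morph1 // -fG mem_morphim.
Qed.

Section OrderEight.

Variables (F : finFieldType) (gT : finGroupType).
Hypothesis oF : #|F| = 2%N.

Lemma gelt_unit (g : gT) : gelt F g \is a GRing.unit.
Proof. by apply: (@galg_unitP _ _ _ (gelt F g^-1)); rewrite -geltM mulgV. Qed.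

Lemma dihedral_noncentral_involution n :
    (1 < n)%N -> dihedral_pres n [set: gT] ->
  ~ central_involutions (unitary_units F gT).
Proof.
move=> n_gt1 /(dihedral_generators n_gt1)[oG [a [b [aN bb ab defG]]]] cV.
pose U g := FinRing.unit _ (gelt_unit g).
have geltV g : U g \in unitary_units F gT.
  by rewrite unitary_unitsE //= star_gelt -geltM mulgV.
have b2 : (U b * U b = 1)%g.
  by apply: val_inj; rewrite /= -geltM -[(b * b)%g]/(b ^+ 2)%g bb.
have /(congr1 val)/ffunP/(_ (b * a)%g) : (U b * U a = U a * U b)%g.
  exact: cV (geltV b) (geltV a) b2.
rewrite /= -!geltM !ffunE eqxx.
have [eq_ba _ | _ /eqP] := eqVneq (b * a)%g (a * b)%g; last by rewrite oner_eq0.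
have [oa _] : #[a]%g = (2 ^ n)%N /\ b \notin <[a]>%g.
  by apply: cyclic_index2 => //; rewrite ?bb ?ab ?groupV ?group1 ?cycle_id.
have /eqP : (a ^+ 2 = 1)%g.
  by rewrite expgS expg1 -{1}[a]invgK -ab conjgE -eq_ba mulKg mulVg.
by rewrite -order_dvdn oa (dvdn_Pexp2l n 1) // leqNgt n_gt1.
Qed.

(** For a fixed h, the elements g with h^g in {h, h^-1} form a group, so it is
    enough to test two generators: a and b when h is a power of a, and a and h
    when h = a^k b. *)
Lemma quaternion8_conj :
    quaternion_pres 2 [set: gT] ->
  forall g h : gT, (h ^ g)%g = h \/ (h ^ g = h^-1)%g.
Proof.
case/(quaternion_generators (ltnSn 1)) => oG [a [b [/= a4 bb ab defG]]] g h.
set N := 'N([set h; (h^-1)%g])%g.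
have memN x : (h ^ x = h)%g \/ (h ^ x = h^-1)%g -> x \in N.
  case=> hx; rewrite inE; apply/subsetP=> _ /imsetP[y /set2P[]-> ->];
    by rewrite !inE ?conjVg hx ?invgK eqxx ?orbT.
suff: g \in N.
  by move/(memJ_norm h); rewrite !inE eqxx => /orP[] /eqP->; [left | right].
suff: [set: gT] \subset N by move/subsetP; apply; rewrite inE.
rewrite -defG join_subG !cycle_subG.
have nab : (<[b]> \subset 'N(<[a]>))%g.
  by rewrite cycle_subG inE -cycleJ cycle_subG ab groupV cycle_id.
have : h \in (<[a]> * <[b]>)%g by rewrite -norm_joinEr // defG inE.
case/mulsgP=> _ _ /cycleP[i ->] /cycleP[j ->] def_h.
have [k [e def_h']] : exists k e, h = (a ^+ k * b ^+ (nat_of_bool e))%g.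
  exists (i + 2 * j./2)%N, (odd j).
  rewrite def_h -{1}[j]odd_double_half addnC -mul2n expgD !expgM bb.
  by rewrite expgD expgM /= mulgA.
case: e def_h' => def_h'; last first.
  have hE : h = (a ^+ k)%g by rewrite def_h' mulg1.
  rewrite !memN //.
    by right; rewrite hE conjXg ab expgVn.
  by left; rewrite hE conjgE -expgSr expgS mulKg.
have aN : a \in N.
  apply: memN; right; rewrite def_h' expg1.
  have bV : (b ^ a = a ^- 2 * b)%g.
    rewrite conjgE (_ : b * a = a^-1 * b)%g; first by rewrite mulgA -invMg.
    by rewrite (conjgC a^-1) conjVg ab invgK.
  have xb : ((a ^+ k * a ^- 2) ^ b = a ^- k * a ^+ 2)%g.
    by rewrite conjMg conjVg !conjXg ab !expgVn invgK.
  have aa : (a ^ a = a)%g by rewrite conjgE mulKg.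
  apply/eqP; rewrite eq_sym eq_invg_mul conjMg conjXg aa bV.
  rewrite (mulgA (a ^+ k)%g _ b) (conjgC (a ^+ k * a ^- 2)%g b) xb mulgA.
  rewrite -(mulgA (a ^+ k)%g) -[(b * b)%g]/(b ^+ 2)%g bb -expgD addnC expgD.
  by rewrite -mulgA mulKVg -expgD a4.
rewrite aN /=; have -> : b = (a ^- k * h)%g by rewrite def_h' mulKg.
rewrite groupM ?groupV ?groupX //; apply: memN; left.
by rewrite conjgE mulKg.
Qed.

(** Unitary involutions are symmetric, and symmetric elements are constant on
    conjugacy classes, since conjugates are equal or inverse. *)
Lemma quaternion8_central_involutions :
  quaternion_pres 2 [set: gT] -> central_involutions (unitary_units F gT).
Proof.
move=> /quaternion8_conj conjG u v; rewrite !unitary_unitsE // => /eqP uu1 _ u2.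
have {u2} sym_u : star (val u) = val u.
  have /(congr1 val) /= u2' := u2.
  by rewrite -[RHS]mulr1 -uu1 mulrA u2' mul1r.
have gelt_comm g : val u * gelt F g = gelt F g * val u.
  apply/ffunP=> h; rewrite galg_mul_gelt_coef gelt_mul_coef.
  have -> : (h * g^-1 = (g^-1 * h) ^ g^-1)%g.
    by rewrite conjgE invgK mulgA mulKVg.
  have [-> // | ->] := conjG g^-1%g (g^-1 * h)%g.
  by rewrite -[in RHS]sym_u [RHS]ffunE.
apply: val_inj => /=; rewrite [val v]galg_sum mulr_suml mulr_sumr.
by apply: eq_bigr => g _; rewrite -scalerAl -scalerAr gelt_comm.
Qed.

End OrderEight.

(** * The isomorphism problem *)

Lemma F2_card : #|'F_2| = 2%N.
Proof. exact: card_Fp. Qed.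

Section Bounds.

Variables (F : finFieldType) (gT : finGroupType) (n : nat).
Hypothesis oF : #|F| = 2%N.

(** These intervals are disjoint for different n. *)
Lemma unitary_units_bounds :
    [\/ (1 < n)%N /\ dihedral_pres n [set: gT],
        (1 < n)%N /\ quaternion_pres n [set: gT]
      | (2 < n)%N /\ semidihedral_pres n [set: gT]] ->
  (2 ^ (2 ^ n) <= #|unitary_units F gT| < 2 ^ (2 ^ n.+1))%N.
Proof.
have lower t z :
    (1 < n)%N -> unitary_pairs F id (Zhalf n) \subset unitary_pairs F t z ->
    #|unitary_units F gT| = #|unitary_pairs F t z| ->
    (2 ^ (2 ^ n) <= #|unitary_units F gT|)%N.
  move=> n_gt1 sub ->; apply: leq_trans (subset_leq_card sub).
  exact: cyclic_pairs_lower.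
have upper := unitary_units_lt gT oF.
have abA : commutative (@mul 'Z_(2 ^ n)) by move=> g h; apply: addrC.
case=> -[n_gt presG].
- have [oG _] := dihedral_generators n_gt presG.
  rewrite -oG upper andbT (lower id 1%g) //; last exact: card_unitary_dihedral.
  exact: (sub_unitary_pairs_id1 oF abA).
- have [oG _] := quaternion_generators n_gt presG.
  rewrite -oG upper andbT (lower id (Zhalf n)) //.
  exact: card_unitary_quaternion.
have [oG _] := semidihedral_generators n_gt presG.
rewrite -oG upper andbT (lower (@Ztwist n) 1%g) ?(ltnW n_gt) //.
  exact: (cyclic_pairs_id_twist oF (ltnW n_gt)).
exact: card_unitary_semidihedral.
Qed.

End Bounds.

Section Distinct.

Variables (F : finFieldType) (gT hT : finGroupType) (n : nat).
Hypothesis oF : #|F| = 2%N.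

(** For n = 2 the two unitary groups have the same order. *)
Lemma quaternion_dihedral_distinct :
    (1 < n)%N -> quaternion_pres n [set: gT] -> dihedral_pres n [set: hT] ->
  ~ unitary_units F gT \isog unitary_units F hT.
Proof.
move=> n_gt1 presG presH isoV.
move: (n_gt1); rewrite leq_eqVlt => /predU1P[n2 | n_gt2].
  rewrite -{}n2 in presG presH.
  apply: (dihedral_noncentral_involution oF (ltnSn 1) presH).
  apply: isog_central_involutions (quaternion8_central_involutions oF presG).
  by rewrite isog_sym.
have := card_isog isoV.
rewrite (card_unitary_quaternion oF n_gt1 presG).
rewrite (card_unitary_dihedral oF n_gt1 presH).
apply/eqP; rewrite neq_ltn proper_card //.
apply: proper_trans (cyclic_pairs_twist_proper oF n_gt1 n_gt2).
exact: cyclic_pairs_id_proper.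
Qed.

Lemma quaternion_semidihedral_distinct :
    (2 < n)%N -> quaternion_pres n [set: gT] -> semidihedral_pres n [set: hT] ->
  ~ unitary_units F gT \isog unitary_units F hT.
Proof.
move=> n_gt2 presG presH /card_isog; have n_gt1 := ltnW n_gt2.
rewrite (card_unitary_quaternion oF n_gt1 presG).
rewrite (card_unitary_semidihedral oF n_gt2 presH).
apply/eqP; rewrite neq_ltn proper_card //.
exact: cyclic_pairs_id_proper.
Qed.

Lemma semidihedral_dihedral_distinct :
    (2 < n)%N -> semidihedral_pres n [set: gT] -> dihedral_pres n [set: hT] ->
  ~ unitary_units F gT \isog unitary_units F hT.
Proof.
move=> n_gt2 presG presH /card_isog; have n_gt1 := ltnW n_gt2.
rewrite (card_unitary_semidihedral oF n_gt2 presG).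
rewrite (card_unitary_dihedral oF n_gt1 presH).
apply/eqP; rewrite neq_ltn proper_card //.
exact: cyclic_pairs_twist_proper.
Qed.

End Distinct.

Local Open Scope group_scope.

Theorem theorem2 (gT hT : finGroupType)
    (hG : maximal_class_2group [set: gT])
    (hH : maximal_class_2group [set: hT]) :
  unitary_units 'F_2 gT \isog unitary_units 'F_2 hT
    <-> [set: gT] \isog [set: hT].
Proof.
split=> [isoV | isoGH]; last exact: unitary_units_isog F2_card isoGH.
have isoV' : unitary_units 'F_2 hT \isog unitary_units 'F_2 gT.
  by rewrite isog_sym.
have [[n presG] [m presH]] := (hG, hH).
have /andP[Gl Gu] := unitary_units_bounds F2_card presG.
have /andP[Hl Hu] := unitary_units_bounds F2_card presH.
rewrite -(card_isog isoV) in Hl Hu.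
have eq_nm : n = m.
  apply/eqP; rewrite eqn_leq -[(n <= m)%N]ltnS -[(m <= n)%N]ltnS.
  have lt_exp i j : (2 ^ (2 ^ i) < 2 ^ (2 ^ j.+1))%N -> (i < j.+1)%N.
    by rewrite !ltn_exp2l.
  by rewrite !lt_exp ?(leq_ltn_trans Gl) ?(leq_ltn_trans Hl).
rewrite -{}eq_nm in presH.
have same p : ([set: gT] \isog Grp p -> [set: hT] \isog Grp p ->
    [set: gT] \isog [set: hT]).
  by move=> Gp Hp; apply: (isoGrp_isog Gp Hp); apply: isoGrp_hom.
case: presH => -[n_gtH presH]; case: presG => -[n_gtG presG];
  try exact: same presG presH.
- by case: (quaternion_dihedral_distinct F2_card n_gtG presG presH).
- by case: (semidihedral_dihedral_distinct F2_card n_gtG presG presH).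
- by case: (quaternion_dihedral_distinct F2_card n_gtG presH presG).
- by case: (quaternion_semidihedral_distinct F2_card n_gtG presH presG).
- by case: (semidihedral_dihedral_distinct F2_card n_gtH presH presG).
by case: (quaternion_semidihedral_distinct F2_card n_gtH presG presH).
Qed.
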